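(* For any $P(z)\in\mathbb{C}[[z]]$ with $o(P)\ge2$ and $(\mathrm{Hes}\,P)(0)$ nilpotent, $P$ is self-inverting if and only if $\langle\nabla P,\nabla P\rangle=0$.
   Context: $z=(z_1,\dots,z_n)$, $\nabla P=(\partial P/\partial z_1,\dots,\partial P/\partial z_n)$, $\langle u,v\rangle=\sum_iu_iv_i$, $\mathrm{Hes}\,P$ is the Hessian matrix, and $o(P)$ is the smallest total degree of a monomial occurring in $P$. For $P\in\mathbb{C}[[z]]$ with $o(P)\ge2$ and $(\mathrm{Hes}\,P)(0)$ nilpotent, the formal map $F(z)=z-\nabla P(z)$ has a formal inverse under composition of the form $G(z)=z+\nabla Q(z)$ for a unique $Q\in\mathbb{C}[[z]]$ with $o(Q)\ge2$, called the inversion pair of $P$. Such a $P$ is self-inverting if its inversion pair satisfies $Q=P$. *)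

(* Defs.v *)
From HB Require Import structures.
From mathcomp Require Import all_boot all_order all_algebra.
From mathcomp Require Import boolp reals.
From mathcomp Require Import complex mpoly.

Set Implicit Arguments.
Unset Strict Implicit.
Unset Printing Implicit Defensive.

Import GRing.Theory.
Local Open Scope ring_scope.

(* Formal power series in n variables, as families of coefficients indexed by
   the exponents 'X_{1..n}.  The record (rather than a bare function type)
   keeps the Cauchy product apart from the pointwise one. *)
Record fps (n : nat) (R : Type) := Fps { fps_coef : 'X_{1..n} -> R }.

Lemma fpsP n (R : Type) (f g : fps n R) : fps_coef f =1 fps_coef g -> f = g.
Proof. by case: f g => [f] [g] /= /funext ->. Qed.

HB.instance Definition _ n (R : Type) := gen_eqMixin (fps n R).
HB.instance Definition _ n (R : Type) := gen_choiceMixin (fps n R).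

Section FpsRing.
Variables (n : nat) (R : comNzRingType).
Implicit Types (f g h : fps n R) (m : 'X_{1..n}).

Definition fps_zero : fps n R := Fps (fun=> 0).
Definition fps_opp f : fps n R := Fps (fun m => - fps_coef f m).
Definition fps_add f g : fps n R := Fps (fun m => fps_coef f m + fps_coef g m).
Definition fps_one : fps n R := Fps (fun m => (m == 0%MM)%:R).
(* The bound on mdeg k only makes the index type finite: it follows from
   (k <= m)%MM. *)
Definition fps_mul f g : fps n R :=
  Fps (fun m => \sum_(k : 'X_{1..n < (mdeg m).+1} | (k <= m)%MM)
                  fps_coef f k * fps_coef g (m - k)%MM).

Fact fps_addA : associative fps_add.
Proof. by move=> f g h; apply: fpsP => m /=; rewrite addrA. Qed.
Fact fps_addC : commutative fps_add.
Proof. by move=> f g; apply: fpsP => m /=; rewrite addrC. Qed.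
Fact fps_add0 : left_id fps_zero fps_add.
Proof. by move=> f; apply: fpsP => m /=; rewrite add0r. Qed.
Fact fps_addN : left_inverse fps_zero fps_opp fps_add.
Proof. by move=> f; apply: fpsP => m /=; rewrite addNr. Qed.

HB.instance Definition _ := GRing.isZmodule.Build (fps n R)
  fps_addA fps_addC fps_add0 fps_addN.

Definition fps_trunc d f : {mpoly R[n]} :=
  \sum_(k : 'X_{1..n < d}) fps_coef f k *: 'X_[k].

Lemma mcoeff_fps_trunc d f m :
  (mdeg m < d)%N -> (fps_trunc d f)@_m = fps_coef f m.
Proof.
move=> md; rewrite /fps_trunc raddf_sum /= (bigD1 (BMultinom md)) //=.
rewrite mcoeffZ mcoeffX eqxx mulr1 big1 ?addr0 // => k nk.
rewrite mcoeffZ mcoeffX; case: eqP => [e|]; last by rewrite mulr0.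
by case/eqP: nk; apply: val_inj.
Qed.

Lemma fps_coefM d f g m : (mdeg m < d)%N ->
  fps_coef (fps_mul f g) m = (fps_trunc d f * fps_trunc d g)@_m.
Proof.
move=> md; rewrite [LHS]/= -[in RHS]/(mpoly_mul _ _).
have -> : (mpoly_mul (fps_trunc d f) (fps_trunc d g))@_m =
  \sum_(k : 'X_{1..n < (mdeg m).+1} | (k <= m)%MM)
    (fps_trunc d f)@_k * (fps_trunc d g)@_(m - k).
  exact: mcoeff_poly_mul_lin.
apply: eq_bigr => k _; rewrite !mcoeff_fps_trunc //.
  exact: leq_ltn_trans (mdegB _ _) md.
by apply: leq_ltn_trans md; rewrite -ltnS bmdeg.
Qed.

Lemma eq_mcoeffM (p p' q q' : {mpoly R[n]}) m :
  (forall k, (mdeg k <= mdeg m)%N -> p@_k = p'@_k) ->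
  (forall k, (mdeg k <= mdeg m)%N -> q@_k = q'@_k) ->
  (p * q)@_m = (p' * q')@_m.
Proof.
move=> ep eq; rewrite !mcoeffM; apply: eq_bigr => k _.
by rewrite ep ?eq // -ltnS bmdeg.
Qed.

Fact fps_mulA : associative fps_mul.
Proof.
move=> f g h; apply: fpsP => m; rewrite !(fps_coefM _ _ (ltnSn (mdeg m))).
set t := fps_trunc (mdeg m).+1.
transitivity (t f * (t g * t h))@_m.
  apply: eq_mcoeffM => // k km; rewrite mcoeff_fps_trunc ?ltnS //.
  exact: fps_coefM.
rewrite mulrA; apply: eq_mcoeffM => // k km.
by rewrite mcoeff_fps_trunc ?ltnS //; apply/esym/fps_coefM.
Qed.

Fact fps_mulC : commutative fps_mul.
Proof.
move=> f g; apply: fpsP => m.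
by rewrite !(fps_coefM _ _ (ltnSn (mdeg m))) mulrC.
Qed.

Fact fps_mul1 : left_id fps_one fps_mul.
Proof.
move=> f; apply: fpsP => m; rewrite (fps_coefM _ _ (ltnSn (mdeg m))).
rewrite -[RHS](mcoeff_fps_trunc _ (ltnSn (mdeg m))) -[in RHS](mul1r (fps_trunc _ f)).
by apply: eq_mcoeffM => // k km; rewrite mcoeff_fps_trunc ?ltnS //= mcoeff1.
Qed.

Fact fps_mulDl : left_distributive fps_mul fps_add.
Proof.
move=> f g h; apply: fpsP => m /=; rewrite -big_split /=.
by apply: eq_bigr => k _; rewrite mulrDl.
Qed.

Fact fps_one_neq0 : fps_one != 0.
Proof.
apply/eqP => /(congr1 (fun f => fps_coef f 0%MM)) /=.
by rewrite eqxx => /eqP; rewrite oner_eq0.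
Qed.

HB.instance Definition _ := GRing.Zmodule_isComNzRing.Build (fps n R)
  fps_mulA fps_mulC fps_mul1 fps_mulDl fps_one_neq0.

End FpsRing.

Section FpsCalculus.
Variables (n : nat) (R : comNzRingType).
Implicit Types (f P Q : fps n R).

Definition fps_X (i : 'I_n) : fps n R := Fps (fun m => (m == U_(i)%MM)%:R).

Definition fps_deriv (i : 'I_n) f : fps n R :=
  Fps (fun m => fps_coef f (m + U_(i))%MM *+ (m i).+1).

(* o(f) >= d: every monomial occurring in f has total degree at least d,
   with o(0) = +oo. *)
Definition fps_order_ge (d : nat) f : Prop :=
  forall m, fps_coef f m != 0 -> (d <= mdeg m)%N.

Definition fps_grad f : 'I_n -> fps n R := fun i => fps_deriv i f.

Definition fps_dot (u v : 'I_n -> fps n R) : fps n R := \sum_(i < n) u i * v i.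

Definition fps_hessian f : 'M[fps n R]_n :=
  \matrix_(i, j) fps_deriv i (fps_deriv j f).

(* (Hes f)(0) *)
Definition fps_hessian0 f : 'M[R]_n :=
  map_mx (fun g => fps_coef g 0%MM) (fps_hessian f).

(* Substitution f(u_1, ..., u_n) of series u_i without constant term.  Then
   \prod_i u_i ^+ k_i has no monomial of degree < mdeg k, so that the terms with
   mdeg k > mdeg m, omitted here, do not contribute to the coefficient of m. *)
Definition fps_subst f (u : 'I_n -> fps n R) : fps n R :=
  Fps (fun m => \sum_(k : 'X_{1..n < (mdeg m).+1})
                  fps_coef f k * fps_coef (\prod_(i < n) u i ^+ k i) m).

Definition fmap_comp (F G : 'I_n -> fps n R) : 'I_n -> fps n R :=
  fun i => fps_subst (F i) G.

Definition fmap_inverse (F G : 'I_n -> fps n R) : Prop :=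
  fmap_comp F G =1 fps_X /\ fmap_comp G F =1 fps_X.

Definition nilpotent_mx (A : 'M[R]_n) : Prop := exists k : nat, A ^+ k = 0.

Definition inversion_pair P Q : Prop :=
  fps_order_ge 2 Q /\
  fmap_inverse (fun i => fps_X i - fps_grad P i)
               (fun i => fps_X i + fps_grad Q i).

Definition self_inverting P : Prop :=
  exists Q, inversion_pair P Q /\ Q = P.

End FpsCalculus.

(* Main.v *)
(* Put w = grad P and let D = sum_j w_j d/dz_j be the associated derivation.
   For a polynomial p, p(z + t w) is a polynomial in t over the power series
   whose coefficient of t is D p; if moreover D w = 0, then its t-derivative is
   its image under D, so that D f = 0 implies f(z + w) = f, a statement which
   passes to power series by truncation.  As d/dz_i <w, w> = 2 D w_i, the
   condition <w, w> = 0 amounts to D w = 0, which hence yields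
   w(z + w) = w = w(z - w), i.e. z + w and z - w are inverse to each other.
   Conversely, if they are, then w(z + w) = w; iterating z + w gives
   w(z + k w) = w for all natural numbers k, so that each coefficient of
   w(z + t w), a polynomial in t, is constant, and D w = 0. *)
Require Import Defs.
From HB Require Import structures.
From mathcomp Require Import all_boot all_order all_algebra.
From mathcomp Require Import reals complex.
From mathcomp Require Import mpoly.

Set Implicit Arguments.
Unset Strict Implicit.
Unset Printing Implicit Defensive.

Import GRing.Theory Num.Theory.
Local Open Scope ring_scope.

(** The common twist [g] makes the set where [d1] and [d2] agree closed under products; additivity
    reduces the claim to products of constants and variables. *)
Lemma mpoly_derivation_ext n (R S : comNzRingType) (g : {mpoly R[n]} -> S)
    (d1 d2 : {additive {mpoly R[n]} -> S}) :
  (forall p q, d1 (p * q) = d1 p * g q + g p * d1 q) ->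
  (forall p q, d2 (p * q) = d2 p * g q + g p * d2 q) ->
  (forall c, d1 c%:MP = d2 c%:MP) -> (forall i, d1 'X_i = d2 'X_i) ->
  d1 =1 d2.
Proof.
move=> d1M d2M dC dX p; rewrite (mpolyE p) !raddf_sum; apply: eq_bigr => m _.
have dMeq q r : d1 q = d2 q -> d1 r = d2 r -> d1 (q * r) = d2 (q * r).
  by move=> eq er; rewrite d1M d2M eq er.
rewrite -mul_mpolyC; apply: (dMeq) => //; rewrite mpolyXE_id.
elim/big_ind: _ => [||i _]; [exact: (dC 1) | exact: (dMeq) |].
by elim: (m i) => [|k IH]; [exact: (dC 1) | rewrite exprS; apply: (dMeq)].
Qed.

(** * Order of a power series, truncation, and embedded polynomials *)

Section Order.
Variables (n : nat) (R : comNzRingType).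
Implicit Types (f g h : fps n R) (d e : nat).

Lemma fps_coefD m f g : fps_coef (f + g) m = fps_coef f m + fps_coef g m.
Proof. by []. Qed.

Lemma fps_coefN m f : fps_coef (- f) m = - fps_coef f m.
Proof. by []. Qed.

Lemma fps_coefB m f g : fps_coef (f - g) m = fps_coef f m - fps_coef g m.
Proof. by []. Qed.

Lemma fps_coef_sum m (I : Type) (r : seq I) (A : pred I) (F : I -> fps n R) :
  fps_coef (\sum_(i <- r | A i) F i) m = \sum_(i <- r | A i) fps_coef (F i) m.
Proof. by elim/big_rec2: _ => // i x y _ <-. Qed.

Lemma fps_coefMn m f k : fps_coef (f *+ k) m = fps_coef f m *+ k.
Proof. by elim: k => // k IH; rewrite !mulrS fps_coefD IH. Qed.

Lemma fps_order_geP d f :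
  fps_order_ge d f <-> forall m, (mdeg m < d)%N -> fps_coef f m = 0.
Proof.
split=> f0 m; first by move=> md; apply: contraTeq md => /f0; rewrite -leqNgt.
by apply: contraR; rewrite -ltnNge => /f0 /eqP.
Qed.

Lemma fps_order_ge0 f : fps_order_ge 0 f.
Proof. by []. Qed.

Lemma fps_order_ge_leq d e f :
  (d <= e)%N -> fps_order_ge e f -> fps_order_ge d f.
Proof. by move=> de fe m /fe; apply: leq_trans. Qed.

Lemma fps_order_ge_zero d : fps_order_ge d (0 : fps n R).
Proof. by move=> m; rewrite eqxx. Qed.

Lemma fps_order_geD d f g :
  fps_order_ge d f -> fps_order_ge d g -> fps_order_ge d (f + g).
Proof.
move=> /fps_order_geP f0 /fps_order_geP g0; apply/fps_order_geP => m md.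
by rewrite fps_coefD f0 // g0 // addr0.
Qed.

Lemma fps_order_geN d f : fps_order_ge d f -> fps_order_ge d (- f).
Proof.
move=> /fps_order_geP f0; apply/fps_order_geP => m md.
by rewrite fps_coefN f0 // oppr0.
Qed.

Lemma fps_order_geB d f g :
  fps_order_ge d f -> fps_order_ge d g -> fps_order_ge d (f - g).
Proof. by move=> f0 g0; apply/fps_order_geD/fps_order_geN. Qed.

Lemma fps_order_geMn d f k : fps_order_ge d f -> fps_order_ge d (f *+ k).
Proof.
move=> /fps_order_geP f0; apply/fps_order_geP => m md.
by rewrite fps_coefMn f0 // mul0rn.
Qed.

Lemma fps_order_ge_sum d (I : Type) (r : seq I) (A : pred I)
    (F : I -> fps n R) :
  (forall i, A i -> fps_order_ge d (F i)) ->
  fps_order_ge d (\sum_(i <- r | A i) F i).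
Proof.
move=> F0; apply: big_ind => //; first exact: fps_order_ge_zero.
exact: fps_order_geD.
Qed.

Lemma fps_order_geM d e f g :
  fps_order_ge d f -> fps_order_ge e g -> fps_order_ge (d + e) (f * g).
Proof.
move=> /fps_order_geP f0 /fps_order_geP g0; apply/fps_order_geP => m md /=.
apply: big1 => k km.
have [kd|dk] := ltnP (mdeg k) d; first by rewrite f0 ?mul0r.
rewrite [X in _ * X]g0 ?mulr0 //; rewrite -(ltn_add2l d).
apply: leq_ltn_trans md.
by rewrite -[in X in (_ <= mdeg X)%N](submK km) mdegD addnC leq_add2l.
Qed.

Lemma fps_order_geMl d f g : fps_order_ge d g -> fps_order_ge d (f * g).
Proof. by move=> g0; apply: (@fps_order_geM 0). Qed.

Lemma fps_order_geX d k f : fps_order_ge d f -> fps_order_ge (d * k) (f ^+ k).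
Proof.
move=> f0; elim: k => [|k IH]; first by rewrite muln0.
by rewrite exprS mulnS; apply: fps_order_geM.
Qed.

(* Congruence modulo series of order at least d is the working substitute for
   equality of truncations; it is compatible with the ring operations. *)
Lemma fps_order_geBM d f f' g g' :
  fps_order_ge d (f - f') -> fps_order_ge d (g - g') ->
  fps_order_ge d (f * g - f' * g').
Proof.
move=> ff gg.
have -> : f * g - f' * g' = g * (f - f') + f' * (g - g').
  by rewrite !mulrBr addrA -(mulrC f) -(mulrC f') subrK.
by apply: fps_order_geD; apply: fps_order_geMl.
Qed.

Lemma fps_order_ge_sym d f g : fps_order_ge d (f - g) -> fps_order_ge d (g - f).
Proof. by move=> /fps_order_geN; rewrite opprB. Qed.

Lemma fps_order_ge_trans d g f h :
  fps_order_ge d (f - g) -> fps_order_ge d (g - h) -> fps_order_ge d (f - h).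
Proof. by move=> fg gh; rewrite -(subrKA g); apply: fps_order_geD. Qed.

(** This carries identities from polynomials to series: they are checked modulo every order, with
    truncations in place of the series. *)
Lemma fps_eq_order_ge f g : (forall d, fps_order_ge d (f - g)) -> f = g.
Proof.
move=> fg; apply: fpsP => m; apply/eqP; rewrite -subr_eq0; apply/eqP.
by have /fps_order_geP := fg (mdeg m).+1; apply; apply: ltnSn.
Qed.

Definition fps_of_mpoly (p : {mpoly R[n]}) : fps n R := Fps (fun m => p@_m).

Lemma fps_of_trunc d f : fps_order_ge d (fps_of_mpoly (fps_trunc d f) - f).
Proof.
apply/fps_order_geP => m md.
by rewrite fps_coefB /= mcoeff_fps_trunc ?subrr.
Qed.

Lemma fps_of_mpoly_is_zmod_morphism : zmod_morphism fps_of_mpoly.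
Proof. by move=> p q; apply: fpsP => m; rewrite fps_coefB /= mcoeffB. Qed.

Lemma fps_of_mpoly_is_monoid_morphism : monoid_morphism fps_of_mpoly.
Proof.
split=> [|p q]; apply: fpsP => m /=; first by rewrite mcoeff1.
have := @mcoeff_poly_mul_lin n R p q m _ (ltnSn _); apply.
Qed.

HB.instance Definition _ := GRing.isZmodMorphism.Build {mpoly R[n]} (fps n R)
  fps_of_mpoly fps_of_mpoly_is_zmod_morphism.
HB.instance Definition _ := GRing.isMonoidMorphism.Build {mpoly R[n]} (fps n R)
  fps_of_mpoly fps_of_mpoly_is_monoid_morphism.

Definition fps_const : R -> fps n R := fps_of_mpoly \o @mpolyC n R.
HB.instance Definition _ := GRing.RMorphism.on fps_const.

Lemma fps_of_mpolyX i : fps_of_mpoly 'X_i = fps_X R i.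
Proof. by apply: fpsP => m /=; rewrite mcoeffX eq_sym. Qed.

Lemma fps_coef_constM c f m : fps_coef (fps_const c * f) m = c * fps_coef f m.
Proof.
rewrite -[in LHS](subrK (fps_of_mpoly (fps_trunc (mdeg m).+1 f)) f) mulrDr.
have -> t : fps_const c * fps_of_mpoly t = fps_of_mpoly (c%:MP * t).
  by rewrite rmorphM.
rewrite fps_coefD /= mcoeffCM mcoeff_fps_trunc //.
rewrite [X in X + _](_ : _ = 0) ?add0r //.
have /(@fps_order_geMl _ (fps_const c))/fps_order_geP :=
  fps_order_ge_sym (@fps_of_trunc (mdeg m).+1 f).
exact.
Qed.

End Order.
Arguments fps_of_trunc {n R} d f.

(** * Partial derivatives *)

Section Deriv.
Variables (n : nat) (R : comNzRingType).
Implicit Types (f g : fps n R).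

Lemma fps_deriv_is_zmod_morphism i : zmod_morphism (@fps_deriv n R i).
Proof. by move=> f g; apply: fpsP => m; rewrite fps_coefB /= mulrnBl. Qed.

HB.instance Definition _ i := GRing.isZmodMorphism.Build (fps n R) (fps n R)
  (@fps_deriv n R i) (fps_deriv_is_zmod_morphism i).

Lemma fps_deriv_of_mpoly i p :
  fps_deriv i (fps_of_mpoly p) = fps_of_mpoly p^`M(i) :> fps n R.
Proof. by apply: fpsP => m /=; rewrite mcoeff_deriv. Qed.

Lemma fps_order_ge_deriv d i f :
  fps_order_ge d.+1 f -> fps_order_ge d (fps_deriv i f).
Proof.
move=> /fps_order_geP f0; apply/fps_order_geP => m md /=.
by rewrite f0 ?mul0rn // mdegD mdeg1 addn1.
Qed.

Arguments fps_order_ge_deriv [d] i [f].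

(** The rule comes from [mderivM] on truncations, cut at [d.+1] because differentiation lowers the
    order by one. *)
Lemma fps_derivM i f g :
  fps_deriv i (f * g) = fps_deriv i f * g + f * fps_deriv i g.
Proof.
apply: fps_eq_order_ge => d.
pose p := fps_of_mpoly (fps_trunc d.+1 f).
pose q := fps_of_mpoly (fps_trunc d.+1 g).
have fp := fps_order_ge_sym (fps_of_trunc d.+1 f).
have gq := fps_order_ge_sym (fps_of_trunc d.+1 g).
have fp' := fps_order_ge_deriv i fp; have gq' := fps_order_ge_deriv i gq.
have fpq := fps_order_ge_deriv i (fps_order_geBM fp gq).
have ipq : p * q = fps_of_mpoly (fps_trunc d.+1 f * fps_trunc d.+1 g).
  by rewrite rmorphM.
move: fp' gq' fpq; rewrite -/p -/q ipq !raddfB /= !fps_deriv_of_mpoly mderivM.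
rewrite rmorphD !rmorphM => fp' gq' fpq.
apply: fps_order_ge_trans fpq _; rewrite opprD addrACA; apply: fps_order_geD.
  apply: fps_order_geBM; apply: fps_order_ge_sym => //.
  exact: fps_order_ge_leq gq.
apply: fps_order_geBM; apply: fps_order_ge_sym => //.
exact: fps_order_ge_leq fp.
Qed.

Lemma fps_deriv_comm i j f :
  fps_deriv i (fps_deriv j f) = fps_deriv j (fps_deriv i f).
Proof.
apply: fpsP => m /=; rewrite !mnmDE !mnm1E -!addmA [(U_(j) + _)%MM]addmC.
rewrite -!mulrnA; congr (_ *+ _).
by case: (eqVneq i j) => [->//|ij]; rewrite !addn0 mulnC.
Qed.

End Deriv.

(** * Substitution and its composition law *)

Section Subst.
Variables (n : nat) (R : comNzRingType).
Implicit Types (f g : fps n R) (p q : {mpoly R[n]}) (u v : 'I_n -> fps n R).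

(** Substitution into polynomials is a ring morphism by construction; [fps_subst], given coefficient
    by coefficient, inherits multiplicativity from it through truncation. *)
Definition fps_eval u : {mpoly R[n]} -> fps n R := mmap (@fps_const n R) u.
HB.instance Definition _ u := GRing.RMorphism.on (fps_eval u).

Lemma fps_evalX u i : fps_eval u 'X_i = u i.
Proof. by rewrite /fps_eval mmapX mmap1U. Qed.

Lemma fps_order_ge_monomial u (k : 'X_{1..n}) :
  (forall i, fps_order_ge 1 (u i)) ->
  fps_order_ge (mdeg k) (\prod_(i < n) u i ^+ k i).
Proof.
move=> u1; rewrite mdegE; elim/big_rec2: _ => [|i d f _ fd].
  exact: fps_order_ge0.
rewrite -[X in (X + _)%N]mul1n; apply: fps_order_geM => //.
exact: fps_order_geX.
Qed.

Lemma fps_order_ge_eval d u p : (forall i, fps_order_ge 1 (u i)) ->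
  fps_order_ge d (fps_of_mpoly p) -> fps_order_ge d (fps_eval u p).
Proof.
move=> u1 /fps_order_geP p0; rewrite /fps_eval /mmap.
apply: fps_order_ge_sum => k _; have [kd|dk] := ltnP (mdeg k) d.
  by rewrite [p@_k]p0 // rmorph0 mul0r; apply: fps_order_ge_zero.
by apply/fps_order_geMl/(fps_order_ge_leq dk)/fps_order_ge_monomial.
Qed.

(** Evaluation at series without constant term never lowers the order, so a polynomial congruent to
    [f] may replace it. *)
Lemma fps_order_ge_subst d u f p : (forall i, fps_order_ge 1 (u i)) ->
  fps_order_ge d (f - fps_of_mpoly p) ->
  fps_order_ge d (fps_subst f u - fps_eval u p).
Proof.
move=> u1 fp; apply/fps_order_geP => m md; set e := (mdeg m).+1.
rewrite fps_coefB.
have -> : fps_coef (fps_subst f u) m = fps_coef (fps_eval u (fps_trunc e f)) m.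
  (* The bound [e] turns the sum over the support into one over all exponents of degree below [e],
     the index set of [fps_subst]. *)
  rewrite /fps_eval (@mmapE _ _ _ _ _ _ e); last first.
    apply: leq_trans (msize_sum _ _ _) _; apply/bigmax_leqP => k _.
    by apply: leq_trans (msizeZ_le _ _) _; rewrite msizeX bmdeg.
  rewrite fps_coef_sum [LHS]/=; apply: eq_bigr => k _.
  by rewrite fps_coef_constM mcoeff_fps_trunc // bmdeg.
rewrite -fps_coefB -raddfB.
suff /fps_order_geP : fps_order_ge e (fps_eval u (fps_trunc e f - p)).
  by apply; apply: ltnSn.
apply: fps_order_ge_eval => //; rewrite raddfB.
apply: fps_order_ge_trans (fps_of_trunc e f) _.
exact: fps_order_ge_leq fp.
Qed.

Lemma fps_subst_trunc d u f : (forall i, fps_order_ge 1 (u i)) ->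
  fps_order_ge d (fps_subst f u - fps_eval u (fps_trunc d f)).
Proof.
by move=> u1; apply/fps_order_ge_subst/fps_order_ge_sym/fps_of_trunc.
Qed.

Lemma fps_subst_of_mpoly u p : (forall i, fps_order_ge 1 (u i)) ->
  fps_subst (fps_of_mpoly p) u = fps_eval u p.
Proof.
move=> u1; apply: fps_eq_order_ge => d; apply: fps_order_ge_subst => //.
by rewrite subrr; apply: fps_order_ge_zero.
Qed.

Lemma fps_substX i u : (forall i, fps_order_ge 1 (u i)) ->
  fps_subst (fps_X R i) u = u i.
Proof.
by move=> u1; rewrite -fps_of_mpolyX fps_subst_of_mpoly // fps_evalX.
Qed.

Lemma fps_substD f g u : fps_subst (f + g) u = fps_subst f u + fps_subst g u.
Proof.
apply: fpsP => m /=; rewrite -big_split; apply: eq_bigr => k _.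
by rewrite /= mulrDl.
Qed.

Lemma fps_substN f u : fps_subst (- f) u = - fps_subst f u.
Proof.
by apply: fpsP => m /=; rewrite -sumrN; apply: eq_bigr => k _; rewrite mulNr.
Qed.

Lemma fps_substMn f k u : fps_subst (f *+ k) u = fps_subst f u *+ k.
Proof.
elim: k => [|k IH]; last by rewrite !mulrS fps_substD IH.
by apply: fpsP => m /=; rewrite big1 // => i _; rewrite mul0r.
Qed.

Lemma fps_substM f g u : (forall i, fps_order_ge 1 (u i)) ->
  fps_subst (f * g) u = fps_subst f u * fps_subst g u.
Proof.
move=> u1; apply: fps_eq_order_ge => d.
apply: (@fps_order_ge_trans _ _ _ (fps_eval u (fps_trunc d f * fps_trunc d g))).
  apply: fps_order_ge_subst => //; rewrite rmorphM.
  by apply: fps_order_geBM; apply/fps_order_ge_sym/fps_of_trunc.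
rewrite rmorphM; apply: fps_order_geBM;
  exact/fps_order_ge_sym/fps_subst_trunc.
Qed.

Lemma fps_order_ge_substl d u f : (forall i, fps_order_ge 1 (u i)) ->
  fps_order_ge d f -> fps_order_ge d (fps_subst f u).
Proof.
move=> u1 fd; have := @fps_order_ge_subst d u f 0 u1.
by rewrite !raddf0 !addr0; apply.
Qed.

(** Substituting [v] is a ring morphism [s] that fixes constants, hence it passes inside the
    evaluation. *)
Lemma fps_subst_eval u v p : (forall i, fps_order_ge 1 (v i)) ->
  fps_subst (fps_eval u p) v = fps_eval (fun i => fps_subst (u i) v) p.
Proof.
move=> v1; pose s f := fps_subst f v.
have sA : zmod_morphism s by move=> f g; rewrite /s fps_substD fps_substN.
have s0 : s 0 = 0 by have := sA 0 0; rewrite !subrr.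
have sc c : s (fps_const n c) = fps_const n c.
  by rewrite /s fps_subst_of_mpoly // /fps_eval mmapC.
have s1 : s 1 = 1 by rewrite -(rmorph1 (@fps_const n R)) sc.
have sM f g : s (f * g) = s f * s g by exact: fps_substM.
have sX f k : s (f ^+ k) = s f ^+ k.
  by elim: k => [|k IH]; rewrite ?expr0 // !exprS sM IH.
rewrite /fps_eval /mmap -[LHS]/(s _).
rewrite (big_morph s (fun f g => fps_substD f g v) s0); apply: eq_bigr => k _.
by rewrite sM sc /mmap1 (big_morph s sM s1); under eq_bigr do rewrite sX.
Qed.

Lemma fps_subst_comp f u v :
  (forall i, fps_order_ge 1 (u i)) -> (forall i, fps_order_ge 1 (v i)) ->
  fps_subst (fps_subst f u) v = fps_subst f (fun i => fps_subst (u i) v).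
Proof.
move=> u1 v1; apply: fps_eq_order_ge => d.
have uv1 i : fps_order_ge 1 (fps_subst (u i) v) by apply: fps_order_ge_substl.
apply: fps_order_ge_trans _ (fps_order_ge_sym (@fps_subst_trunc d _ f uv1)).
rewrite -fps_subst_eval // -fps_substN -fps_substD.
exact/(fps_order_ge_substl v1)/fps_subst_trunc.
Qed.

End Subst.
Arguments fps_subst_trunc {n R} d [u] f.

(** * The derivation D along a vector field, and its flow on polynomials *)

Section Flow.
Variables (n : nat) (R : comNzRingType) (w : 'I_n -> fps n R).
Implicit Types (f g : fps n R) (p : {mpoly R[n]}).

Definition fps_lie f : fps n R := \sum_(j < n) w j * fps_deriv j f.

Lemma fps_lie_is_zmod_morphism : zmod_morphism fps_lie.
Proof.
move=> f g; rewrite -sumrB; apply: eq_bigr => j _.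
by rewrite raddfB mulrBr.
Qed.

HB.instance Definition _ := GRing.isZmodMorphism.Build (fps n R) (fps n R)
  fps_lie fps_lie_is_zmod_morphism.

Lemma fps_lieM f g : fps_lie (f * g) = fps_lie f * g + f * fps_lie g.
Proof.
rewrite mulr_suml mulr_sumr -big_split; apply: eq_bigr => j _ /=.
by rewrite fps_derivM mulrDr mulrA [w j * (f * _)]mulrCA.
Qed.

Lemma fps_lie_const c : fps_lie (fps_const n c) = 0.
Proof.
apply: big1 => j _.
rewrite -[fps_const n c]/(fps_of_mpoly _) fps_deriv_of_mpoly mderivC.
by rewrite raddf0 mulr0.
Qed.

Lemma fps_lieX i : fps_lie (fps_X R i) = w i.
Proof.
have dX j : fps_deriv j (fps_X R i) = (i == j)%:R.
  rewrite -fps_of_mpolyX fps_deriv_of_mpoly mderivX mnm1E scaler_nat.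
  have [->|_] := eqVneq i j; last by rewrite raddf0.
  by have := addmK U_(j) 0%MM; rewrite add0m => ->; rewrite mpolyX0 rmorph1.
rewrite /fps_lie (bigD1 i) //= dX eqxx mulr1 big1 ?addr0 // => j ji.
by rewrite dX eq_sym (negPf ji) mulr0.
Qed.

(** The factor [w j] restores the degree lost by differentiation, so D respects congruences modulo
    order [d]. *)
Lemma fps_order_ge_lie d f : (forall i, fps_order_ge 1 (w i)) ->
  fps_order_ge d f -> fps_order_ge d (fps_lie f).
Proof.
move=> w1; case: d => [|d] fd; first exact: fps_order_ge0.
apply: fps_order_ge_sum => j _; apply: (@fps_order_geM _ _ 1 d) => //.
exact: fps_order_ge_deriv.
Qed.

(* The Taylor expansion of p(z + t w) in powers of the variable t = 'X. *)
Definition fps_flow : {mpoly R[n]} -> {poly fps n R} :=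
  mmap (polyC \o @fps_const n R) (fun i => (fps_X R i)%:P + (w i)%:P * 'X).
HB.instance Definition _ := GRing.RMorphism.on fps_flow.

Lemma horner_fps_flow p c :
  (fps_flow p).[c] = fps_eval (fun i => fps_X R i + w i * c) p.
Proof.
rewrite -[LHS]/(horner_eval c _) /fps_flow /fps_eval /mmap raddf_sum /=.
apply: eq_bigr => k _; rewrite rmorphM /= /horner_eval hornerC; congr (_ * _).
rewrite /mmap1 -[LHS]/(horner_eval c _) rmorph_prod; apply: eq_bigr => i _.
by rewrite rmorphXn /= /horner_eval !hornerE.
Qed.

Lemma fps_eval_id p : fps_eval (@fps_X n R) p = fps_of_mpoly p.
Proof.
rewrite {2}(mpolyE p) raddf_sum; apply: eq_bigr => k _ /=.
rewrite -mul_mpolyC rmorphM mpolyXE_id rmorph_prod; congr (_ * _).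
by apply: eq_bigr => i _; rewrite rmorphXn /= fps_of_mpolyX.
Qed.

Lemma fps_flow0 p : (fps_flow p).[0] = fps_of_mpoly p.
Proof.
rewrite horner_fps_flow -fps_eval_id; apply: eq_bigr => k _; congr (_ * _).
by apply: eq_bigr => i _; rewrite mulr0 addr0.
Qed.

Lemma fps_flowC c : fps_flow c%:MP = (fps_const n c)%:P.
Proof. by rewrite /fps_flow mmapC. Qed.

Lemma fps_flowX i : fps_flow 'X_i = (fps_X R i)%:P + (w i)%:P * 'X.
Proof. by rewrite /fps_flow mmapX mmap1U. Qed.

(** The flow at t = 0 is [fps_of_mpoly], so both sides are derivations over that embedding; both
    kill constants and send the i-th variable to [w i]. *)
Lemma deriv_fps_flow0 p : (fps_flow p)^`().[0] = fps_lie (fps_of_mpoly p).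
Proof.
apply: (@mpoly_derivation_ext _ _ _ (@fps_of_mpoly n R)
  (horner_eval 0 \o deriv \o fps_flow) (fps_lie \o @fps_of_mpoly n R))
  => [q r|q r|c|i] /=; rewrite ?rmorphM /=.
- by rewrite derivM /horner_eval hornerD !hornerM !fps_flow0.
- exact: fps_lieM.
- by rewrite fps_flowC derivC /horner_eval horner0 fps_lie_const.
- rewrite fps_flowX fps_of_mpolyX fps_lieX derivD derivC derivM derivC derivX.
  by rewrite /horner_eval !hornerE.
Qed.

(* Both sides are derivations of p that agree on the variables. *)
Lemma deriv_fps_flow p : (forall i, fps_lie (w i) = 0) ->
  (fps_flow p)^`() = map_poly fps_lie (fps_flow p).
Proof.
move=> ww; have lieM (a b : {poly fps n R}) : map_poly fps_lie (a * b) =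
    map_poly fps_lie a * b + a * map_poly fps_lie b.
  apply/polyP => k; rewrite coefD coef_map !coefM raddf_sum -big_split.
  by apply: eq_bigr => i _ /=; rewrite fps_lieM !coef_map.
apply: (@mpoly_derivation_ext _ _ _ fps_flow
  (deriv \o fps_flow) (map_poly fps_lie \o fps_flow)) => [q r|q r|c|i] /=.
- by rewrite rmorphM derivM.
- by rewrite rmorphM lieM.
- by rewrite fps_flowC derivC map_polyC /= fps_lie_const.
- rewrite fps_flowX; apply/polyP => k.
  rewrite coef_map coefD coefCM coefC coefX coef_deriv coefD coefCM coefC coefX.
  (* Both constant coefficients are [w i]; at t the left side has 0 and the right side D [(w i)],
     which vanishes by [ww]. *)
  case: k => [|[|k]] /=;
    by rewrite !(mulr0, mulr1, addr0, add0r, mul0rn, raddf0, fps_lieX, ww).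
Qed.

End Flow.

(** * Invariance under the flow in characteristic zero *)

Section CharZero.
Variables (n : nat) (R : numDomainType).
Implicit Types (f : fps n R) (w : 'I_n -> fps n R).

Lemma fps_order_ge_var i : fps_order_ge 1 (fps_X R i : fps n R).
Proof.
by move=> m /=; have [->|_] := eqVneq m U_(i)%MM; rewrite ?mdeg1 ?eqxx.
Qed.

Lemma fps_order_ge_mulrn d f k :
  fps_order_ge d (f *+ k.+1) -> fps_order_ge d f.
Proof.
move=> fd m fm; apply: fd; rewrite fps_coefMn.
by rewrite mulrn_eq0.
Qed.

Lemma fps_mulrn_eq0 f k : f *+ k.+1 = 0 -> f = 0.
Proof.
move=> f0; apply: fps_eq_order_ge => d; rewrite subr0.
by apply: (@fps_order_ge_mulrn d f k); rewrite f0; apply: fps_order_ge_zero.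
Qed.

(** If [m i] is positive, the i-th derivative contains the coefficient of [m] multiplied by [m i],
    and [R] has no torsion. *)
Lemma fps_deriv_eq0 f :
  fps_coef f 0%MM = 0 -> (forall i, fps_deriv i f = 0) -> f = 0.
Proof.
move=> f0 df; apply: fpsP => m; have [->//|m0] := eqVneq m 0%MM.
have [i mi] : exists i, (0 < m i)%N.
  apply/existsP; apply: contraR m0; rewrite negb_exists => /forallP m0.
  by apply/eqP/mnmP => i; rewrite mnm0E; apply/eqP; rewrite -leqn0 leqNgt.
have := congr1 (fun g => fps_coef g (m - U_(i))%MM) (df i) => /= /eqP.
rewrite mulrn_eq0 submK; first by move=> /eqP.
by apply/mnm_lepP => j; rewrite mnm1E; case: eqP => [<-|].
Qed.

(** Natural numbers stay distinct in [R], so a nonzero [q] would have [size q] roots, one more than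
    its degree. *)
Lemma poly_nat_roots (q : {poly R}) : (forall k : nat, q.[k%:R] = 0) -> q = 0.
Proof.
move=> q0; apply: (@roots_geq_poly_eq0 _ _ [seq i%:R | i <- iota 0 (size q)]).
- by apply/allP => _ /mapP[k _ ->]; rewrite /root q0.
- rewrite map_inj_uniq ?iota_uniq // => i j /eqP.
  by rewrite eqr_nat => /eqP.
- by rewrite size_map size_iota.
Qed.

(** Let c_k be the coefficients in t of the flow of a truncation of [f]. Since (k+1) c_(k+1) = D
    c_k, the congruence D c_0 = 0 modulo order [d] propagates to all c_k with k > 0, and the value
    at t = 1 reduces to c_0. *)
Lemma fps_subst_flow w f : (forall i, fps_order_ge 1 (w i)) ->
  (forall i, fps_lie w (w i) = 0) -> fps_lie w f = 0 ->
  fps_subst f (fun i => fps_X R i + w i) = f.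
Proof.
move=> w1 ww wf.
apply: fps_eq_order_ge => d; pose p := fps_trunc d f.
have Xw1 i : fps_order_ge 1 (fps_X R i + w i).
  by apply: fps_order_geD => //; apply: fps_order_ge_var.
apply: fps_order_ge_trans (fps_subst_trunc d f Xw1) _.
apply: fps_order_ge_trans _ (fps_of_trunc d f).
have -> : fps_eval (fun i => fps_X R i + w i) p = (fps_flow w p).[1].
  rewrite horner_fps_flow; apply: eq_bigr => k _; congr (_ * _).
  by apply: eq_bigr => i _; rewrite mulr1.
have lie_flow k :
    (fps_flow w p)`_k.+1 *+ k.+1 = fps_lie w (fps_flow w p)`_k.
  by rewrite -coef_deriv deriv_fps_flow // coef_map.
have flowS k : fps_order_ge d (fps_flow w p)`_k.+1.
  elim: k => [|k IH]; last first.
    apply: (@fps_order_ge_mulrn _ _ k.+1); rewrite lie_flow.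
    exact: fps_order_ge_lie.
  apply: (@fps_order_ge_mulrn _ _ 0); rewrite lie_flow -horner_coef0 fps_flow0.
  (* As D f = 0, D p equals D (p - f), and p - f has order at least [d]. *)
  rewrite -[fps_lie _ _]subr0 -wf -raddfB; apply: fps_order_ge_lie => //.
  exact: fps_of_trunc.
have <- : (fps_flow w p)`_0 = fps_of_mpoly p by rewrite -horner_coef0 fps_flow0.
rewrite (horner_coef_wide _ (leqnSn (size (fps_flow w p)))).
rewrite big_ord_recl expr0 mulr1 addrC addKr; apply: fps_order_ge_sum => i _.
by rewrite expr1n mulr1; apply: (flowS i).
Qed.

(** For fixed [m], the coefficient of [m] in the flow is a polynomial in t with the same value at
    every natural number, hence constant; its linear coefficient is that of [m] in D f. *)
Lemma fps_lie_subst w f : (forall i, fps_order_ge 1 (w i)) ->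
  (forall k, fps_subst f (fun i => fps_X R i + w i *+ k) = f) ->
  fps_lie w f = 0.
Proof.
move=> w1 wf.
apply: fpsP => m; set d := (mdeg m).+1; pose p := fps_trunc d f.
have coef_cong (g h : fps n R) :
    fps_order_ge d (g - h) -> fps_coef g m = fps_coef h m.
  move=> /fps_order_geP/(_ m (ltnSn _))/eqP.
  by rewrite fps_coefB subr_eq0 => /eqP.
pose q := \poly_(i < size (fps_flow w p)) fps_coef (fps_flow w p)`_i m.
have qE k : q.[k%:R] = fps_coef f m.
  rewrite -[in RHS](wf k) (coef_cong _ _ (fps_subst_trunc _ _ _)); last first.
    move=> i; apply/fps_order_geD/fps_order_geMn => //.
    exact: fps_order_ge_var.
  have -> : fps_eval (fun i => fps_X R i + w i *+ k) p = (fps_flow w p).[k%:R].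
    rewrite horner_fps_flow; apply: eq_bigr => j _; congr (_ * _).
    by apply: eq_bigr => i _; rewrite mulr_natr.
  rewrite horner_poly horner_coef fps_coef_sum; apply: eq_bigr => i _.
  by rewrite -!natrX !mulr_natr fps_coefMn.
have /(congr1 (fun r : {poly R} => r`_1)) : q - (fps_coef f m)%:P = 0.
  by apply: poly_nat_roots => k; rewrite !hornerE qE subrr.
rewrite coefB coefC subr0 coef0 coef_poly => q1.
rewrite -(coef_cong (fps_lie w (fps_of_mpoly p))); last first.
  by rewrite -raddfB; apply: fps_order_ge_lie => //; apply: fps_of_trunc.
rewrite -deriv_fps_flow0 horner_coef0 coef_deriv mulr1n.
(* If the flow is constant in t, its coefficient of index 1 is the default value 0. *)
by case: ltnP q1 => // s1 _; rewrite nth_default.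
Qed.

End CharZero.

Lemma fps_lieN n (R : comNzRingType) (w : 'I_n -> fps n R) f :
  fps_lie (fun j => - w j) f = - fps_lie w f.
Proof. by rewrite -sumrN; apply: eq_bigr => j _; rewrite mulNr. Qed.

(** * The gradient as a vector field *)

Section Gradient.
Variables (n : nat) (R : numDomainType) (P : fps n R).
Hypothesis P2 : fps_order_ge 2 P.
Local Notation w := (fps_grad P).

Let w1 i : fps_order_ge 1 (w i).
Proof. exact: fps_order_ge_deriv. Qed.

(** Mixed partials commute, so d_i w_j = d_j w_i; this is where [w] being a gradient enters. *)
Lemma fps_deriv_dot_grad i :
  fps_deriv i (fps_dot w w) = fps_lie w (w i) *+ 2.
Proof.
rewrite raddf_sum -sumrMnl; apply: eq_bigr => j _.
by rewrite /= fps_derivM [_ * w j]mulrC -mulr2n /fps_grad fps_deriv_comm.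
Qed.

(** If D w = 0, all partial derivatives of <w, w> vanish, and so does its constant term since [w]
    has order at least 1. The other direction divides by 2. *)
Lemma fps_dot_grad_eq0 :
  fps_dot w w = 0 <-> (forall i, fps_lie w (w i) = 0).
Proof.
split=> [ww i | ww].
  by apply: (@fps_mulrn_eq0 _ _ _ 1); rewrite -fps_deriv_dot_grad ww raddf0.
apply: fps_deriv_eq0 => [|i]; last by rewrite fps_deriv_dot_grad ww mul0rn.
have /fps_order_geP : fps_order_ge 1 (fps_dot w w).
  by apply: fps_order_ge_sum => i _; apply: fps_order_geMl.
by apply; rewrite mdeg0.
Qed.

(* Composing G = z + w with itself k times gives z + k w, because w o G = w. *)
Lemma fps_subst_add_gradMn i k :
  (forall j, fps_subst (w j) (fun l => fps_X R l + w l) = w j) ->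
  fps_subst (w i) (fun l => fps_X R l + w l *+ k) = w i.
Proof.
move=> wG; have G1 e l : fps_order_ge 1 (fps_X R l + w l *+ e).
  by apply: fps_order_geD; [apply: fps_order_ge_var | apply: fps_order_geMn].
elim: k => [|k IH].
  (* Substituting the variables themselves is the flow of the zero field. *)
  rewrite -[RHS](fps_subst_flow (w := fun=> 0)).
  - by congr fps_subst; apply: boolp.funext => l; rewrite mulr0n.
  - by move=> l; apply: fps_order_ge_zero.
  - by move=> l; rewrite raddf0.
  - by apply: big1 => j _; rewrite mul0r.
(* Substituting G into z + k w sends z to z + w and fixes k w. *)
rewrite -[in RHS](wG i) -[in RHS]IH fps_subst_comp => [|l|l].
- congr fps_subst; apply: boolp.funext => l.
  rewrite fps_substD fps_substMn wG fps_substX ?mulrS ?addrA // => j.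
  exact: (G1 1).
- exact: G1.
- exact: (G1 1).
Qed.

End Gradient.

(** * Self-inversion and isotropy of the gradient over the complex numbers *)

Theorem proposition4p3 (R : realType) (n : nat) (P : fps n R[i])
    (hP : fps_order_ge 2 P) (hHes : nilpotent_mx (fps_hessian0 P)) :
  self_inverting P <-> fps_dot (fps_grad P) (fps_grad P) = 0.
Proof.
have [lie_grad0 dot_grad0] := fps_dot_grad_eq0 hP; set w := fps_grad P.
have w1 i : fps_order_ge 1 (w i) by apply: fps_order_ge_deriv.
have G1 i : fps_order_ge 1 (fps_X R[i] i + w i).
  by apply: fps_order_geD => //; apply: fps_order_ge_var.
have F1 i : fps_order_ge 1 (fps_X R[i] i - w i).
  by apply: fps_order_geB => //; apply: fps_order_ge_var.
split=> [[Q [[_ [FG _]] QP]] | /lie_grad0 ww].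
  rewrite {}QP in FG.
  apply: dot_grad0 => i; apply: fps_lie_subst => // k.
  apply: fps_subst_add_gradMn => // j.
  (* The identity F(G) = z reads z_j + w_j - w_j(G) = z_j, that is, w_j(G) = w_j. *)
  have := FG j; rewrite /fmap_comp fps_substD fps_substN fps_substX // => /eqP.
  by rewrite -addrA -subr_eq0 addrAC subrr add0r subr_eq0 => /eqP.
exists P; split=> //; split=> //; split=> i; rewrite /fmap_comp.
  by rewrite fps_substD fps_substN fps_substX // fps_subst_flow ?addrK.
rewrite fps_substD fps_substX //.
(* G(F) = z needs w(z - w) = w, the flow of the field -w, along which [w] is again constant. *)
rewrite (@fps_subst_flow _ _ (fun j => - w j)) ?subrK //.
- by move=> j; apply: fps_order_geN.
- by move=> j; rewrite fps_lieN raddfN /= ww !oppr0.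
- by rewrite fps_lieN ww oppr0.
Qed.
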